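(* Let $\mathcal{D}$ be a dissection of the annulus $A_{n,m}$. Let $\mathcal{F}_{out}=(m_{i,j})$ be the $n$-periodic infinite frieze pattern determined with respect to the outer boundary and $\mathcal{F}_{in}=(m'_{i,j})$ the $m$-periodic infinite frieze pattern determined with respect to the inner boundary, and let $s_1^{out}=m_{0,n+1}-m_{1,n}$ and $s_1^{in}=m'_{0,m+1}-m'_{1,m}$ be their first growth coefficients. Then $s_1^{in}=s_1^{out}$.
   Context: $A_{n,m}$ is an annulus with $n\ge1$ marked points $v_1,\ldots,v_n$ on the outer boundary and $m\ge1$ marked points $w_1,\ldots,w_m$ on the inner boundary, each labelled in counterclockwise order. A dissection is a set of pairwise non-crossing arcs between marked points dividing the annulus into polygons (subgons), with the convention that no arc has both endpoints on the inner boundary. $\lambda_p=2\cos(\pi/p)$. $\mathcal{F}_{out}$ is the frieze pattern (array $(m_{i,j})_{j\ge i}$ with $m_{i,i}=0$, $m_{i,i+1}=1$, $m_{i-1,j}m_{i,j+1}-m_{i,j}m_{i+1,j+1}=1$) whose quiddity entries are $m_{i-1,i+1}=\sum\lambda_{|\mathcal{P}|}$ over the subgons $\mathcal{P}$ incident to $v_{i\bmod n}$ (counted by corners at the vertex); $\mathcal{F}_{in}$ is defined the same way using the inner vertices $w_{i\bmod m}$.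
   Formalization: The frieze rule as printed in the setting (last factor m_{i+1,j+1}) would force consecutive quiddity entries to multiply to 2, so no such pattern exists; the standard rule m_{i-1,j}m_{i,j+1}-m_{i,j}m_{i-1,j+1}=1 for i≤j is used instead. *)

(* Defs.v *)
From HB Require Import structures.
From mathcomp Require Import all_boot all_order all_algebra.
From mathcomp Require Import boolp classical_sets fsbigop reals trigo.

Set Implicit Arguments.
Unset Strict Implicit.
Unset Printing Implicit Defensive.

Import Order.TTheory GRing.Theory Num.Theory.

Local Open Scope classical_set_scope.
Local Open Scope ring_scope.

(* Isotopy classes of arcs of the annulus A_{n,m} are handled through the
   universal cover, a closed strip.  [inl i] is the i-th lift of an outer marked
   point, lying over v_{i mod n}; [inr j] is the j-th lift of an inner marked
   point, lying over w_{j mod m}.  Both boundaries being labelled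
   counterclockwise, both indices increase in the same direction, and the deck
   group is generated by [deck n m]. *)
Definition vertex : Type := (int + int)%type.

Definition deck (n m : nat) (p : vertex) : vertex :=
  match p with
  | inl i => inl (i + n%:Z)
  | inr j => inr (j + m%:Z)
  end.

Definition is_inner (p : vertex) : bool := if p is inr _ then true else false.

(* The order in which the marked points are met along the boundary of the strip
   (a disc with two boundary points removed), starting from the left end: the
   outer boundary from left to right, then the inner one from right to left. *)
Definition vlt (p q : vertex) : bool :=
  match p, q with
  | inl i, inl j => i < j
  | inl _, inr _ => true
  | inr _, inl _ => false
  | inr i, inr j => j < i
  end.

(* Arcs and boundary segments of the strip are pairs (p, q) with [vlt p q]; in a
   disc such a pair determines the arc up to isotopy. *)
Definition segment (e : vertex * vertex) : bool :=
  match e with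
  | (inl i, inl j) => j == i + 1
  | (inr i, inr j) => i == j + 1
  | _ => false
  end.

Definition crossing (e f : vertex * vertex) : bool :=
  [&& vlt e.1 f.1, vlt f.1 e.2 & vlt e.2 f.2]
  || [&& vlt f.1 e.1, vlt e.1 f.2 & vlt f.2 e.2].

Definition edge (D : set (vertex * vertex)) (e : vertex * vertex) : Prop :=
  D e \/ segment e.

Definition sides (P : seq vertex) : seq (vertex * vertex) :=
  if P is p :: s then (p, last p s) :: zip P s else [::].

(* A lifted subgon is given by its vertices listed in [vlt]-order: its sides are
   arcs of D or boundary segments, and no arc of D is a diagonal of it. *)
Definition subgon (D : set (vertex * vertex)) (P : seq vertex) : Prop :=
  [/\ (3 <= size P)%N,
      sorted vlt P,
      forall e, e \in sides P -> edge D e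
    & forall p q, p \in P -> q \in P -> D (p, q) -> (p, q) \in sides P].

(* D is the full preimage in the strip of a set of arcs of the annulus.  That the
   lifts do not cross says both that the arcs of the annulus are pairwise
   non-crossing and that each of them is simple.
   The regions cut out are polygons: each boundary segment borders a subgon, and
   each arc (p, q) borders one on either of its sides, namely one whose other
   vertices lie between p and q, and one whose other vertices do not. *)
Record dissection (n m : nat) (D : set (vertex * vertex)) : Prop := {
  dissection_deck : forall p q, D (p, q) <-> D (deck n m p, deck n m q);
  dissection_arc : forall p q, D (p, q) -> vlt p q && ~~ segment (p, q);
  dissection_inner : forall p q, D (p, q) -> ~~ (is_inner p && is_inner q);
  dissection_noncrossing : forall e f, D e -> D f -> ~~ crossing e f;
  dissection_between : forall p q, D (p, q) ->
    exists s, subgon D (p :: rcons s q);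
  dissection_outside : forall p q, edge D (p, q) ->
    exists s1 s2, subgon D (s1 ++ p :: q :: s2)
}.

Definition lambda (R : realType) (p : nat) : R := 2 * cos (pi / p%:R).

(* The corners at a marked point of the annulus correspond bijectively to the
   lifted subgons having a fixed lift [v] of it as a vertex. *)
Definition corner_sum (R : realType) (D : set (vertex * vertex)) (v : vertex)
    : R :=
  \sum_(P \in [set P | subgon D P /\ v \in P]) lambda R (size P).

(* Only the entries M i j with i <= j are meaningful. *)
Definition frieze (R : realType) (M : int -> int -> R) : Prop :=
  [/\ forall i, M i i = 0,
      forall i, M i (i + 1) = 1
    & forall i j : int, i <= j ->
        M (i - 1) j * M i (j + 1) - M i j * M (i - 1) (j + 1) = 1].

Definition has_quiddity (R : realType) (M : int -> int -> R) (a : int -> R)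
    : Prop :=
  forall i, M (i - 1) (i + 1) = a i.

Definition is_out_frieze (R : realType) (D : set (vertex * vertex))
    (M : int -> int -> R) : Prop :=
  frieze M /\ has_quiddity M (fun i => corner_sum R D (inl i)).

Definition is_in_frieze (R : realType) (D : set (vertex * vertex))
    (M : int -> int -> R) : Prop :=
  frieze M /\ has_quiddity M (fun j => corner_sum R D (inr j)).

Definition growth1 (R : realType) (N : nat) (M : int -> int -> R) : R :=
  M 0 (N%:Z + 1) - M 1 N%:Z.

(* Main.v *)
Require Import Defs.
From HB Require Import structures.
From mathcomp Require Import all_boot all_order all_algebra.
From mathcomp Require Import boolp classical_sets functions cardinality fsbigop.
From mathcomp Require Import reals trigo.
From mathcomp Require Import zify ring.

(** Develop the dissection of the strip into the plane: glueing regular p-gons,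
    in which consecutive vectors satisfy y_{k-1} + y_{k+1} = lambda_p y_k, along
    common edges gives a vector z(v) for each lifted marked point v such that
    det(z(p), z(q)) = 1 on every edge p < q.  Summing around v gives
    z(prev v) + z(next v) = corner_sum(v) z(v), so the entries of both friezes are
    determinants of these vectors.  The deck transformation acts on all of them,
    outer and inner, through one matrix T, and both growth coefficients equal the
    trace of T.

    Coordinate functions z are used instead of vectors.  A solution of the two
    boundary recurrences is matched along one bridging arc f, and the matching is
    carried to the bridging arcs left of f by induction through subgons.  As a
    frieze is determined by its quiddity sequence only if no entry vanishes, one
    also needs a solution that is positive on a large window: positivity at the
    ends of a bridging arc spreads to all vertices between them. *)

Section Dissection.
Set Implicit Arguments.
Unset Strict Implicit.
Import Order.TTheory GRing.Theory Num.Theory.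
Local Open Scope classical_set_scope.
Local Open Scope ring_scope.

(** * Sine recurrences in a regular polygon *)

(* With t = pi / p, the values are (sin (k t) y_1 - sin ((k - 1) t) y_0) / sin t. *)
Lemma polygon_recurrence (R : realType) (p : nat) (y : nat -> R) : (2 < p)%N ->
  (forall k, (k.+2 < p)%N -> y k + y k.+2 = lambda R p * y k.+1) ->
  [/\ y p.-1 = y 1 - lambda R p * y 0,
      y 0 = y p.-2 - lambda R p * y p.-1
    & 0 < y 0 -> 0 < y p.-1 -> forall k, (k < p)%N -> 0 < y k].
Proof.
case: p => [|[|[|q]]] // _ rec; rewrite !PeanoNat.Nat.pred_succ.
pose t : R := pi / q.+3%:R; pose S (k : nat) : R := sin (k%:R * t).
have piE : q.+3%:R * t = pi by rewrite /t mulrC divfK // pnatr_eq0.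
have t_gt0 : 0 < t by rewrite divr_gt0 ?pi_gt0 ?ltr0n.
have S_gt0 k : (0 < k < q.+3)%N -> 0 < S k.
  move=> /andP[k0 kq]; apply: sin_gt0_pi; rewrite -piE mulr_gt0 ?ltr0n //=.
  by rewrite ltr_pM2r // ltr_nat.
have S0 : S 0 = 0 by rewrite /S mul0r sin0.
have Ssym k : (k <= q.+3)%N -> S (q.+3 - k)%N = S k.
  move=> kq; rewrite /S natrB // mulrBl piE sinB sinpi cospi.
  by rewrite mul0r sub0r mulN1r opprK.
set l := lambda R q.+3.
have SS k : S k.+2 = l * S k.+1 - S k.
  rewrite /S /l /lambda -/t.
  have -> : k.+2%:R * t = k.+1%:R * t + t by rewrite -(natr1 k.+1) mulrDl mul1r.
  have -> : k%:R * t = k.+1%:R * t - t by rewrite -(natr1 k) mulrDl mul1r addrK.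
  by rewrite sinB sinD; ring.
have S1 : 0 < S 1 by exact: S_gt0.
have yE k : (k.+1 < q.+3)%N -> S 1 * y k.+1 = S k.+1 * y 1 - S k * y 0.
  suff H : ((k.+1 < q.+3)%N -> S 1 * y k.+1 = S k.+1 * y 1 - S k * y 0) /\
    ((k.+2 < q.+3)%N -> S 1 * y k.+2 = S k.+2 * y 1 - S k.+1 * y 0) by case: H.
  elim: k => [|k [IH1 IH2]]; split => //.
  - by rewrite S0 mul0r subr0.
  - move=> kq; have := rec 0 kq; rewrite SS S0 -/l => E.
    have -> : y 2 = l * y 1 - y 0 by rewrite -E addrC addKr.
    by ring.
  - move=> kq; have E := rec k.+1 kq; rewrite -/l in E.
    have -> : y k.+3 = l * y k.+2 - y k.+1 by rewrite -E addrC addKr.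
    rewrite mulrBr mulrCA IH1 ?IH2 ?(ltnW kq) //; last exact/ltnW/ltnW.
    by rewrite (SS k.+1) (SS k); ring.
(* The polygon has [q.+3] vertices; the symmetry [Ssym] expresses the last sines through [S 1] and
   [l]. *)
have Sq2 : S q.+2 = S 1 by have := Ssym 1 isT; rewrite subSS subn0.
have Sq1 : S q.+1 = l * S 1.
  by have := Ssym 2 isT; rewrite !subSS subn0 (SS 0) S0 subr0.
have Sq : S q = l * (l * S 1) - S 1.
  by have := Ssym 3 isT; rewrite !subSS subn0 (SS 1) (SS 0) S0 subr0.
have E1 : y q.+2 = y 1 - l * y 0.
  apply: (mulfI (lt0r_neq0 S1)); rewrite yE // Sq2 Sq1; ring.
have E2 : y q.+1 = l * y 1 - (l * l - 1) * y 0.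
  apply: (mulfI (lt0r_neq0 S1)); rewrite yE // Sq1 Sq; ring.
split => //; first by rewrite E1 E2; ring.
move=> y0 yl [//|k] kq; rewrite -(pmulr_rgt0 _ S1) yE //.
(* Expressing [y 1] through the two end values leaves only nonnegative sine coefficients. The
   coefficient [S k.+2] vanishes exactly at the last vertex. *)
have -> : y 1 = y q.+2 + l * y 0 by rewrite E1; ring.
have -> : S k.+1 * (y q.+2 + l * y 0) - S k * y 0 = S k.+1 * y q.+2 + S k.+2 * y 0.
  by rewrite SS; ring.
apply: ltr_wpDr; last by rewrite mulr_gt0 ?S_gt0.
move: kq; rewrite leq_eqVlt => /orP[/eqP [->]|kq].
  by rewrite /S piE sinpi mul0r.
by rewrite mulr_ge0 ?ltW // S_gt0.
Qed.

(** * Three-term recurrences, and frieze entries as determinants *)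

Definition recurrence (R : realType) (a u : int -> R) : Prop :=
  forall i, u (i - 1) + u (i + 1) = a i * u i.

Lemma recurrence_exists (R : realType) (a : int -> R) (k0 : int) (s t : R) :
  exists u, [/\ recurrence a u, u k0 = s & u (k0 + 1) = t].
Proof.
suff H b : exists u, [/\ recurrence b u, u 0 = s & u 1 = t].
  have [u [ru u0 u1]] := H (fun i => a (i + k0)).
  exists (fun i => u (i - k0)); split; last 2 first.
  - by rewrite subrr.
  - by rewrite (_ : k0 + 1 - k0 = 1) //; ring.
  move=> i; have := ru (i - k0); rewrite subrK => <-.
  by congr (u _ + u _); ring.
(* [F] runs forwards and [G] backwards from 0, each carrying two consecutive values; [Negz k] is
   -(k+1), hence [G k.+1]. *)
pose F := fix F (k : nat) : R * R := if k is k'.+1 then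
  ((F k').2, b k'.+1%:Z * (F k').2 - (F k').1) else (s, t).
pose G := fix G (k : nat) : R * R := if k is k'.+1 then
  (b (- k'%:Z) * (G k').1 - (G k').2, (G k').1) else (s, t).
pose u (i : int) : R := match i with Posz k => (F k).1 | Negz k => (G k.+1).1 end.
exists u; split => // -[[|k]|[|k]].
- by rewrite sub0r add0r /= subrK.
- rewrite (_ : Posz k.+1 - 1 = Posz k); last by lia.
  rewrite (_ : Posz k.+1 + 1 = Posz k.+2); last by lia.
  by rewrite /= addrC subrK.
- rewrite (_ : Negz 0 - 1 = Negz 1) // (_ : Negz 0 + 1 = 0) //=.
  by rewrite subrK.
- rewrite (_ : Negz k.+1 - 1 = Negz k.+2); last by lia.
  rewrite (_ : Negz k.+1 + 1 = Negz k); last by lia.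
  by rewrite /= subrK.
Qed.

Lemma recurrence_eq0 (R : realType) (a u : int -> R) (k0 : int) :
  recurrence a u -> u k0 = 0 -> u (k0 + 1) = 0 -> forall i, u i = 0.
Proof.
move=> ru u0 u1.
have fwd (k : nat) : u (k0 + k%:Z) = 0 /\ u (k0 + k%:Z + 1) = 0.
  elim: k => [|k [IH1 IH2]]; first by rewrite addr0.
  have := ru (k0 + k%:Z + 1); rewrite addrK IH1 IH2 mulr0 add0r => E.
  by rewrite -[k.+1]addn1 PoszD addrA.
have bwd (k : nat) : u (k0 - k%:Z) = 0 /\ u (k0 - k%:Z + 1) = 0.
  elim: k => [|k [IH1 IH2]]; first by rewrite subr0.
  have := ru (k0 - k%:Z); rewrite IH1 IH2 mulr0 addr0 => E.
  by rewrite -[k.+1]addn1 PoszD opprD addrA subrK.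
move=> i; have [h|h] := lerP k0 i.
  by have [] := fwd `|i - k0|%N; rewrite (_ : k0 + _ = i) //; lia.
by have [] := bwd `|i - k0|%N; rewrite (_ : k0 - _ = i) //; lia.
Qed.

(** The determinant of the vectors with coordinates ([u], [v]) at [p] and [q]. The type [T] is the
    integers along one boundary and [vertex] across the strip. *)
Definition wronskian (T : Type) (R : realType) (u v : T -> R) (p q : T) : R :=
  u p * v q - u q * v p.

(** One step of the recurrence is a linear map of determinant 1. *)
Lemma wronskian_const (R : realType) (a u v : int -> R) (k0 : int) :
  recurrence a u -> recurrence a v ->
  forall i, wronskian u v i (i + 1) = wronskian u v k0 (k0 + 1).
Proof.
move=> ru rv.
have step i : wronskian u v i (i + 1) = wronskian u v (i - 1) (i - 1 + 1).
  rewrite subrK /wronskian.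
  have -> : u (i + 1) = a i * u i - u (i - 1) by rewrite -ru; ring.
  have -> : v (i + 1) = a i * v i - v (i - 1) by rewrite -rv; ring.
  by ring.
have fwd (k : nat) i : wronskian u v (i + k%:Z) (i + k%:Z + 1) =
    wronskian u v i (i + 1).
  elim: k => [|k IH]; first by rewrite addr0.
  by rewrite step -[k.+1]addn1 PoszD addrA addrK.
move=> i; have [h|h] := lerP k0 i.
  by rewrite -(fwd `|i - k0|%N k0) (_ : k0 + _ = i) //; lia.
by rewrite -(fwd `|i - k0|%N i) (_ : i + _ = k0) //; lia.
Qed.

(* Sturm comparison: w i _ / f is increasing, because the Wronskian of w i _ and
   f is constant and positive. *)
Lemma wronskian_gt0 (R : realType) (a u v f : int -> R) (lo hi : int) :
  recurrence a u -> recurrence a v -> recurrence a f ->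
  (forall i, wronskian u v i (i + 1) = 1) ->
  (forall i, lo <= i -> i <= hi -> 0 < f i) ->
  forall i (k : nat), lo <= i -> i + k.+1%:Z <= hi ->
    0 < wronskian u v i (i + k.+1%:Z).
Proof.
move=> ru rv rf uv1 fpos i k loi.
have id (l : nat) : wronskian u v i (i + l.+1%:Z) * f (i + l%:Z) -
    wronskian u v i (i + l%:Z) * f (i + l.+1%:Z) = f i.
  elim: l => [|l IH].
    by rewrite uv1 addr0 /wronskian; ring.
  rewrite -{}[RHS]IH; set j := i + l.+1%:Z.
  have -> : i + l.+2%:Z = j + 1 by rewrite /j; lia.
  have -> : i + l%:Z = j - 1 by rewrite /j; lia.
  have eu : u (j + 1) = a j * u j - u (j - 1) by rewrite -ru; ring.
  have ev : v (j + 1) = a j * v j - v (j - 1) by rewrite -rv; ring.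
  have ef : f (j + 1) = a j * f j - f (j - 1) by rewrite -rf; ring.
  by rewrite /wronskian eu ev ef; ring.
elim: k => [|k IH] ihi; first by rewrite uv1.
have /eqP := id k.+1; rewrite subr_eq => /eqP E.
have f1 : 0 < f (i + k.+1%:Z) by apply: fpos; lia.
rewrite -(pmulr_lgt0 _ f1) E addr_gt0 //; first by apply: fpos; lia.
by rewrite mulr_gt0 ?IH ?fpos //; lia.
Qed.

(** Induction on the width [j - i], two widths at a time: the frieze rule yields the widest entry
    after division by the narrowest one, which [wronskian_gt0] keeps nonzero as long as [f] is
    positive on the window. *)
Lemma frieze_wronskian (R : realType) (M : int -> int -> R)
    (a u v f : int -> R) (lo hi : int) :
  frieze M -> has_quiddity M a ->
  recurrence a u -> recurrence a v -> recurrence a f ->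
  (forall i, wronskian u v i (i + 1) = 1) ->
  (forall i, lo <= i -> i <= hi -> 0 < f i) ->
  forall i j, lo <= i -> i <= j -> j <= hi -> M i j = wronskian u v i j.
Proof.
move=> [M0 M1 Mrule] Mq ru rv rf uv1 fpos.
suff H (k : nat) : (forall i, lo <= i -> i + k%:Z <= hi ->
      M i (i + k%:Z) = wronskian u v i (i + k%:Z)) /\
    (forall i, lo <= i -> i + k.+1%:Z <= hi ->
      M i (i + k.+1%:Z) = wronskian u v i (i + k.+1%:Z)).
  move=> i j loi ij jhi; have [+ _] := H `|j - i|%N => /(_ i loi).
  by rewrite (_ : i + _ = j); [exact|lia].
elim: k => [|k [IH1 IH2]].
  split=> i _ _; first by rewrite addr0 M0 /wronskian mulrC subrr.
  by rewrite M1 uv1.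
split => // i loi ihi; case: k IH1 IH2 ihi => [|k] IH1 IH2 ihi.
  (* At width 2 the divisor would be a diagonal zero, so the quiddity supplies the entry. *)
  have := Mq (i + 1); rewrite addrK -addrA => ->.
  have ru' := ru (i + 1); have rv' := rv (i + 1).
  rewrite addrK -addrA in ru'; rewrite addrK -addrA in rv'.
  have eu : u (i + 2%:Z) = a (i + 1) * u (i + 1) - u i by rewrite -ru'; ring.
  have ev : v (i + 2%:Z) = a (i + 1) * v (i + 1) - v i by rewrite -rv'; ring.
  by rewrite /wronskian eu ev -[LHS]mulr1 -(uv1 i) /wronskian; ring.
set j := i + 1 + k.+1%:Z.
have j2 : i + k.+2%:Z = j by rewrite /j; lia.
have j3 : i + k.+3%:Z = j + 1 by rewrite /j; lia.
have Mij : M i j = wronskian u v i j.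
  by rewrite -j2 IH2 //; lia.
have Mij1 : M (i + 1) (j + 1) = wronskian u v (i + 1) (j + 1).
  by rewrite (_ : j + 1 = i + 1 + k.+2%:Z) ?IH2 //; rewrite ?/j; lia.
have Mi1j : M (i + 1) j = wronskian u v (i + 1) j.
  by rewrite /j IH1 //; lia.
have wne : wronskian u v (i + 1) j != 0.
  rewrite gt_eqF // /j; apply: (wronskian_gt0 ru rv rf uv1 fpos); lia.
have := Mrule (i + 1) j; rewrite addrK Mij Mij1 Mi1j => /(_ _) E.
have {}E : wronskian u v i j * wronskian u v (i + 1) (j + 1) -
    wronskian u v (i + 1) j * M i (j + 1) = 1 by apply: E; rewrite /j; lia.
rewrite j3; apply: (mulfI wne).
have -> : wronskian u v (i + 1) j * M i (j + 1) =
  wronskian u v i j * wronskian u v (i + 1) (j + 1) - 1 by rewrite -E; ring.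
(* With 1 written as a product of two unit determinants, the claim is the Plücker relation for i,
   i+1, j, j+1. *)
have -> : (1 : R) = wronskian u v i (i + 1) * wronskian u v j (j + 1).
  by rewrite !uv1 mulr1.
by rewrite /wronskian; ring.
Qed.

(* Boolean hypotheses about vertices make [lia] blow up. *)
Ltac nlia :=
  repeat match goal with
  | H : ?T |- _ =>
    lazymatch type of T with
    | Prop => lazymatch T with is_true (leq _ _) => fail | _ => clear H end
    end
  end; lia.

(** * The boundary order of the strip *)

Local Notation vtx := (nth (inl 0 : vertex)).

Definition vle (p q : vertex) : bool := ~~ vlt q p.

Definition between (p q x : vertex) : bool := vle p x && vle x q.

Definition strictly_between (p q x : vertex) : bool := vlt p x && vlt x q.

(** Neighbours in the order [vlt], along which inner indices decrease. *)
Definition vnext (p : vertex) : vertex :=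
  match p with inl i => inl (i + 1) | inr j => inr (j - 1) end.

Definition vprev (p : vertex) : vertex :=
  match p with inl i => inl (i - 1) | inr j => inr (j + 1) end.

Lemma vltxx p : vlt p p = false.
Proof. by case: p => i /=; lia. Qed.

Lemma vlt_trans : transitive vlt.
Proof. by move=> [j|j] [i|i] [k|k] //=; lia. Qed.

Lemma vltW p q : vlt p q -> vle p q.
Proof. by rewrite /vle; case: p q => [i|i] [j|j] //=; lia. Qed.

Lemma vlexx p : vle p p.
Proof. by rewrite /vle vltxx. Qed.

Lemma vle_lt_trans q p r : vle p q -> vlt q r -> vlt p r.
Proof. by rewrite /vle; case: p q r => [i|i] [j|j] [k|k] //=; lia. Qed.

Lemma vlt_le_trans q p r : vlt p q -> vle q r -> vlt p r.
Proof. by rewrite /vle; case: p q r => [i|i] [j|j] [k|k] //=; lia. Qed.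

Lemma vle_trans q p r : vle p q -> vle q r -> vle p r.
Proof. by rewrite /vle; case: p q r => [i|i] [j|j] [k|k] //=; lia. Qed.

Lemma vle_eqVlt p q : vle p q -> p = q \/ vlt p q.
Proof.
rewrite /vle; case: p q => [i|i] [j|j] //= h; try by right.
- by have [->|] := eqVneq i j; [left|right; lia].
- by have [->|] := eqVneq i j; [left|right; lia].
Qed.

Lemma vle_anti p q : vle p q -> vle q p -> p = q.
Proof. by case/vle_eqVlt => // lt_pq; rewrite /vle lt_pq. Qed.

Lemma segment_next p q : segment (p, q) = (q == vnext p).
Proof.
case: p q => [i|i] [j|j] //=.
by apply/eqP/eqP => [->|[->]]; [rewrite addrK|rewrite subrK].
Qed.

Lemma vnext_lt p : vlt p (vnext p).
Proof. by case: p => i /=; lia. Qed.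

Lemma vnextK : cancel vnext vprev.
Proof. by case=> i /=; rewrite ?addrK ?subrK. Qed.

Lemma not_strictly_between_next p x : ~~ strictly_between p (vnext p) x.
Proof. by rewrite /strictly_between; case: p x => [i|i] [j|j] //=; lia. Qed.

Lemma segment_lt e : segment e -> vlt e.1 e.2.
Proof. by case: e => p q; rewrite segment_next => /eqP ->; exact: vnext_lt. Qed.

Lemma segment_crossing p q f : segment (p, q) -> ~~ crossing (p, q) f.
Proof.
rewrite segment_next => /eqP ->; have ns := not_strictly_between_next p.
rewrite /crossing /=; apply/negP => /orP[] /and3P[h1 h2 h3].
- by move: (ns f.1); rewrite /strictly_between h1 h2.
- by move: (ns f.2); rewrite /strictly_between h2 h3.
Qed.

(** * Sides and sorted vertex lists of subgons *)

Lemma side_consec P k : (k.+1 < size P)%N -> (vtx P k, vtx P k.+1) \in sides P.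
Proof.
case: P => [//|p s] /= ks; rewrite inE; apply/orP; right.
have -> : (nth (inl 0) (p :: s) k, nth (inl 0) s k) =
  nth (inl 0 : vertex, inl 0 : vertex) (zip (p :: s) s) k.
  by rewrite nth_zip_cond size_zip /= ifT //; move: ks => /=; lia.
by apply: mem_nth; rewrite size_zip (minn_idPr (leqnSn _)); exact: ks.
Qed.

Lemma side_ends P : (0 < size P)%N -> (vtx P 0, vtx P (size P).-1) \in sides P.
Proof.
by case: P => [//|p s] _; rewrite inE nth_last eqxx.
Qed.

Lemma sideP P e : e \in sides P -> e = (vtx P 0, vtx P (size P).-1) \/
  exists2 k, (k.+1 < size P)%N & e = (vtx P k, vtx P k.+1).
Proof.
case: P => [//|p s]; rewrite inE => /orP[/eqP ->|]; first by left; rewrite nth_last.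
move=> /(nthP (inl 0 : vertex, inl 0 : vertex))[k].
rewrite size_zip (minn_idPr (leqnSn _)) => ks <-.
right; exists k; first exact: ks.
by rewrite nth_zip_cond size_zip (minn_idPr (leqnSn _)) ks.
Qed.

Lemma mem_vtx (P : seq vertex) k : (k < size P)%N -> vtx P k \in P.
Proof. exact: mem_nth. Qed.

Lemma vtxP (P : seq vertex) (x : vertex) : x \in P ->
  exists2 i, (i < size P)%N & vtx P i = x.
Proof. by case/(nthP (inl 0 : vertex)) => i; exists i. Qed.

Lemma sorted_vtx_lt P i j : sorted vlt P -> (i < j)%N -> (j < size P)%N ->
  vlt (vtx P i) (vtx P j).
Proof.
move=> sP ij jP; apply: (sorted_ltn_nth vlt_trans _ sP) => //.
by rewrite inE; nlia.
Qed.

Lemma sorted_vtx_le P i j : sorted vlt P -> (i <= j)%N -> (j < size P)%N ->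
  vle (vtx P i) (vtx P j).
Proof.
move=> sP; rewrite leq_eqVlt => /orP[/eqP <- _|ij jP]; first exact: vlexx.
by apply: vltW; apply: sorted_vtx_lt.
Qed.

Lemma sorted_vtx_ltn P i j : sorted vlt P -> (i < size P)%N ->
  vlt (vtx P i) (vtx P j) -> (i < j)%N.
Proof.
move=> sP iP lt_ij; rewrite ltnNge; apply/negP => ji.
by have := sorted_vtx_le sP ji iP; rewrite /vle lt_ij.
Qed.

Lemma sorted_vtx_leq P i j : sorted vlt P -> (i < size P)%N ->
  vle (vtx P i) (vtx P j) -> (i <= j)%N.
Proof.
move=> sP iP lt_ij; rewrite leqNgt; apply/negP => ji.
by move: lt_ij; rewrite /vle sorted_vtx_lt.
Qed.

(** A discrete intermediate value principle; it finds the side along which a vertex list passes a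
    given point of the boundary. *)
Lemma vtx_switch (B : pred vertex) P i j : (i <= j)%N ->
  ~~ B (vtx P i) -> B (vtx P j) ->
  exists k, [/\ (i <= k)%N, (k < j)%N, ~~ B (vtx P k) & B (vtx P k.+1)].
Proof.
move=> + Bi; elim: j => [|j IHj] ij Bj.
  by move: ij Bi; rewrite leqn0 => /eqP ->; rewrite Bj.
case: (boolP (B (vtx P j))) => Bj'.
  have ij' : (i <= j)%N.
    by move: ij; rewrite leq_eqVlt => /orP[/eqP E|//]; rewrite E Bj in Bi.
  by have [k [? ? ? ?]] := IHj ij' Bj'; exists k; split => //; nlia.
exists j; split => //.
by move: ij; rewrite leq_eqVlt => /orP[/eqP E|//]; rewrite E Bj in Bi.
Qed.

(** * Position of subgons relative to arcs and to one another *)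

Section Subgons.
Context (n m : nat) (D : set (vertex * vertex)) (dD : dissection n m D).

Lemma edge_lt p q : edge D (p, q) -> vlt p q.
Proof.
by case=> [/(dissection_arc dD)/andP[]//|/segment_lt].
Qed.

Lemma edge_crossing e f : edge D e -> D f -> ~~ crossing e f.
Proof.
case=> [De Df|]; first exact: (dissection_noncrossing dD).
by case: e => p q /segment_crossing.
Qed.

(* A side of P leaving the open interval must end at p or at q, so both p and q
   would be vertices of P, and (p, q) a diagonal. *)
Lemma subgon_one_side (p q : vertex) (P : seq vertex) (x y : vertex) :
  D (p, q) -> subgon D P ->
  x \in P -> strictly_between p q x -> y \in P -> between p q y.
Proof.
move=> Dpq [sz sP eP dP] xP /andP[px xq] yP.
have noX k : (k.+1 < size P)%N -> ~~ crossing (vtx P k, vtx P k.+1) (p, q).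
  by move=> kP; apply: edge_crossing => //; apply: eP; exact: side_consec.
have noL : ~~ crossing (vtx P 0, vtx P (size P).-1) (p, q).
  by apply: edge_crossing => //; apply: eP; apply: side_ends; nlia.
have pq := vlt_trans px xq.
have [ix ixs Ex] := vtxP xP.
have [iy iys Ey] := vtxP yP.
have x0 : vle (vtx P 0) x by rewrite -Ex; apply: sorted_vtx_le.
have xl : vle x (vtx P (size P).-1) by rewrite -Ex; apply: sorted_vtx_le => //; nlia.
have y0 : vle (vtx P 0) y by rewrite -Ey; apply: sorted_vtx_le.
have yl : vle y (vtx P (size P).-1) by rewrite -Ey; apply: sorted_vtx_le => //; nlia.
(* If [p] and [q] are both in [P], the arc is a side. As [x] lies strictly inside, its ends are not
   consecutive, so they are the first and last vertex and nothing of [P] lies outside. *)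
have nodiag : p \in P -> q \in P -> ~ (vlt y p \/ vlt q y).
  move=> pP qP; have := dP _ _ pP qP Dpq; case/sideP => [[E1 E2]|[k ks [E1 E2]]].
  - by rewrite E1 E2; case=> h; [move: y0|move: yl]; rewrite /vle h.
  - move=> _; have ki : (k < ix)%N.
      by apply: (sorted_vtx_ltn sP); [exact: ltnW|rewrite -E1 Ex].
    have : (ix < k.+1)%N by apply: (sorted_vtx_ltn sP) => //; rewrite -E2 Ex.
    by rewrite ltnS leqNgt ki.
apply/andP; split; apply/negP => yo.
- have iyx : (iy <= ix)%N.
    by apply: (sorted_vtx_leq sP) => //; rewrite Ex Ey; apply: vltW; apply: vlt_trans yo _.
  have [||k [ik kx Bk Bk1]] := @vtx_switch (vle p) P iy ix iyx.
    by rewrite Ey /vle yo.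
    by rewrite Ex vltW.
  have k1x : vle (vtx P k.+1) x by rewrite -Ex; apply: sorted_vtx_le.
  have Pk : vtx P k.+1 = p.
    case/vle_eqVlt: Bk1 => // pk1; have := noX k.
    rewrite /crossing /= pk1 (vle_lt_trans k1x xq).
    by move: Bk; rewrite /vle negbK => ->; rewrite /= => /(_ _)/negP; case => //; nlia.
  have pP : p \in P by rewrite -Pk; apply: mem_vtx; nlia.
  (* If the last vertex came before [q], the side joining the first and last vertex would cross the
     arc. *)
  case: (boolP (vle q (vtx P (size P).-1))) => ql; last first.
    move: noL; rewrite /crossing /= (vle_lt_trans y0 yo) (vlt_le_trans px xl).
    by move: ql; rewrite /vle negbK => ->.
  have [|||l [il lx Bl Bl1]] := @vtx_switch (vle q) P ix (size P).-1.
  + nlia.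
  + by rewrite Ex /vle xq.
  + by [].
  have xPl : vle x (vtx P l) by rewrite -Ex; apply: sorted_vtx_le => //; nlia.
  have Pl : vtx P l.+1 = q.
    case/vle_eqVlt: Bl1 => // ql1; have := noX l.
    rewrite /crossing /= ql1 (vlt_le_trans px xPl).
    by move: Bl; rewrite /vle negbK => ->; rewrite orbT => /(_ _)/negP; case => //; nlia.
  have qP : q \in P by rewrite -Pl; apply: mem_vtx; nlia.
  by apply: nodiag => //; left.
- have iyx : (ix <= iy)%N.
    by apply: (sorted_vtx_leq sP) => //; rewrite Ex Ey; apply: vltW; apply: vlt_trans yo.
  have [||k [ik kx Bk Bk1]] := @vtx_switch (vlt q) P ix iy iyx.
    by rewrite Ex; apply: vltW.
    by rewrite Ey.
  have xk : vle x (vtx P k) by rewrite -Ex; apply: sorted_vtx_le => //; nlia.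
  have Pk : vtx P k = q.
    case/vle_eqVlt: Bk => // pk1; have := noX k.
    rewrite /crossing /= pk1 Bk1 (vlt_le_trans px xk) orbT.
    by move=> /(_ _)/negP; case => //; nlia.
  have qP : q \in P by rewrite -Pk; apply: mem_vtx; nlia.
  case: (boolP (vlt p (vtx P 0))) => p0.
    move: noL; rewrite /crossing /= p0 (vle_lt_trans x0 xq) (vlt_le_trans yo yl).
    by rewrite orbT.
  have [|||l [il lx Bl Bl1]] := @vtx_switch (vlt p) P 0 ix.
  + nlia.
  + by [].
  + by rewrite Ex.
  have lPx : vle (vtx P l.+1) x by rewrite -Ex; apply: sorted_vtx_le => //; nlia.
  have Pl : vtx P l = p.
    case/vle_eqVlt: Bl => // ql1; have := noX l.
    rewrite /crossing /= ql1 Bl1 (vle_lt_trans lPx xq).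
    by move=> /(_ _)/negP; case => //; nlia.
  have pP : p \in P by rewrite -Pl; apply: mem_vtx; nlia.
  by apply: nodiag => //; right.
Qed.

Lemma consec_gap (Q : seq vertex) k (y : vertex) : sorted vlt Q ->
  (k.+1 < size Q)%N -> y \in Q -> ~~ strictly_between (vtx Q k) (vtx Q k.+1) y.
Proof.
move=> sQ kQ yQ; have [i iQ <-] := vtxP yQ; apply/negP => /andP[h1 h2].
have ki : (k < i)%N by apply: (sorted_vtx_ltn sQ) => //; exact: ltnW.
have ik : (i < k.+1)%N by apply: (sorted_vtx_ltn sQ).
nlia.
Qed.

Lemma vtx_locate (Q : seq vertex) (x : vertex) :
  between (vtx Q 0) (vtx Q (size Q).-1) x ->
  x = vtx Q (size Q).-1 \/
  exists k, [/\ (k.+1 < size Q)%N, vle (vtx Q k) x & vlt x (vtx Q k.+1)].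
Proof.
move=> /andP[x0 xl]; case/vle_eqVlt: (xl) => [|xl']; [by left|right].
have [//|k [_ k1 k2 k3]] := @vtx_switch (vlt x) Q 0 (size Q).-1 _ x0 xl'.
by exists k; split => //; nlia.
Qed.

(** For arcs of [D] this is part of [subgon]; a boundary segment has no vertex strictly between its
    ends, which are therefore consecutive in [Q]. *)
Lemma subgon_edge_side (Q : seq vertex) (c d : vertex) : subgon D Q ->
  c \in Q -> d \in Q -> edge D (c, d) -> (c, d) \in sides Q.
Proof.
move=> [sz sQ eQ dQ] cQ dQ' [Dcd|]; first exact: dQ.
rewrite segment_next => /eqP E.
have [s sQs Es] := vtxP cQ; have [t tQ Et] := vtxP dQ'.
have st : (s < t)%N.
  by apply: (sorted_vtx_ltn sQ) => //; rewrite Es Et E; exact: vnext_lt.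
have [E1|ne] := eqVneq t s.+1.
  by rewrite -Es -Et E1; apply: side_consec; rewrite -E1.
have st1 : (s.+1 < t)%N by rewrite ltn_neqAle eq_sym ne.
have := not_strictly_between_next c (vtx Q s.+1).
rewrite /strictly_between -E -Es -Et sorted_vtx_lt //=; last exact: ltn_trans tQ.
by rewrite sorted_vtx_lt.
Qed.

(** If [P] does not fit behind a single side of [Q], [subgon_one_side] keeps its vertices out of all
    gaps of [Q], so they are vertices of [Q]. The sides of [P] are then sides of [Q], which forces
    equality. *)
Lemma subgon_nested (P Q : seq vertex) : subgon D P -> subgon D Q ->
  all (between (vtx Q 0) (vtx Q (size Q).-1)) P ->
  P = Q \/ exists2 k, (k.+1 < size Q)%N &
    all (between (vtx Q k) (vtx Q k.+1)) P.
Proof.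
move=> gP gQ /allP PQ; have [szP sP eP _] := gP; have [szQ sQ eQ _] := gQ.
case: (pselect (exists2 k, (k.+1 < size Q)%N &
    all (between (vtx Q k) (vtx Q k.+1)) P)) => [|nin]; [by right|left].
have out k (x : vertex) : (k.+1 < size Q)%N -> x \in P ->
    ~~ strictly_between (vtx Q k) (vtx Q k.+1) x.
  move=> kQ xP; apply/negP => sx; case: (eQ _ (side_consec kQ)).
    move=> Dk; apply: nin; exists k => //; apply/allP => y yP.
    exact: (subgon_one_side Dk gP xP sx yP).
  rewrite segment_next => /eqP E; move: sx.
  by rewrite E (negbTE (not_strictly_between_next _ _)).
have sub (x : vertex) : x \in P -> x \in Q.
  move=> xP; case: (vtx_locate (PQ _ xP)) => [->|[k [kQ k1 k2]]].
    by apply: mem_vtx; nlia.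
  case/vle_eqVlt: k1 => [<-|k1]; first by apply: mem_vtx; exact: ltnW.
  by have := out k x kQ xP; rewrite /strictly_between k1 k2.
have consec k : (k.+1 < size P)%N -> exists2 l, (l.+1 < size Q)%N &
    (vtx P k, vtx P k.+1) = (vtx Q l, vtx Q l.+1).
  move=> kP; have kP' := ltnW kP.
  have : (vtx P k, vtx P k.+1) \in sides Q.
    by apply: subgon_edge_side; rewrite ?sub ?mem_vtx //; apply: eP; exact: side_consec.
  (* Consecutive vertices of [P] at the two extremes of [Q] would push a third vertex of [P] out of
     range. *)
  case/sideP => // -[E1 E2]; exfalso.
  case: k kP kP' E1 E2 => [|k] kP kP' E1 E2.
    have /andP[_] := PQ _ (mem_vtx szP).
    by rewrite -E2 /vle sorted_vtx_lt.
  have P0 : (0 < size P)%N by nlia.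
  have /andP[] := PQ _ (mem_vtx P0).
  by rewrite -E1 /vle sorted_vtx_lt.
have P0 : (0 < size P)%N by nlia.
have Pl : ((size P).-1 < size P)%N by nlia.
have [E0 El] : vtx P 0 = vtx Q 0 /\ vtx P (size P).-1 = vtx Q (size Q).-1.
  have : (vtx P 0, vtx P (size P).-1) \in sides Q.
    by apply: subgon_edge_side; rewrite ?sub ?mem_vtx //; apply: eP; exact: side_ends.
  case/sideP => [[-> ->] //|[k kQ [E1 E2]]]; exfalso.
  have P1 : (1 < size P)%N by nlia.
  have := consec_gap sQ kQ (sub _ (mem_vtx P1)).
  rewrite /strictly_between -E1 -E2 sorted_vtx_lt // sorted_vtx_lt //.
  by nlia.
apply: (irr_sorted_eq vlt_trans vltxx sP sQ) => y; apply/idP/idP; first exact: sub.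
move=> yQ; have [i iQ Ei] := vtxP yQ.
have : between (vtx P 0) (vtx P (size P).-1) y.
  rewrite E0 El /between -Ei; apply/andP; split.
    by apply: sorted_vtx_le.
  by apply: sorted_vtx_le => //; nlia.
case/vtx_locate => [->|[k [kP k1 k2]]]; first exact: mem_vtx.
case/vle_eqVlt: k1 => [<-|k1]; first by apply: mem_vtx; exact: ltnW.
have [l lQ [E1 E2]] := consec k kP.
by have := consec_gap sQ lQ yQ; rewrite /strictly_between -E1 -E2 k1 k2.
Qed.

(** * Bridging arcs, and finiteness of the corners at a vertex *)

(** A subgon bordering an inner boundary segment must start at an outer vertex, since no arc joins
    two inner points. The side where its vertex list passes from outer to inner is a bridging
    arc. *)
Lemma bridge_exists : exists i j, D (inl i, inr j).
Proof.
have [|s1 [s2]] := @dissection_outside _ _ _ dD (inr 1) (inr 0); first by right.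
set P := _ ++ _ => gP; have [sz sP eP _] := gP.
have P0 : (0 < size P)%N by nlia.
have P1 : (1 < size P)%N by nlia.
have Pl : ((size P).-1 < size P)%N by nlia.
have inP : (inr 1 : vertex) \in P by rewrite mem_cat inE eqxx orbT.
have outer0 : ~~ is_inner (vtx P 0).
  apply/negP => in0; have inl0 : is_inner (vtx P (size P).-1).
    have := sorted_vtx_le sP (leq0n _) Pl; rewrite /vle.
    by case: (vtx P 0) in0 => // j _; case: (vtx P _).
  case: (eP _ (side_ends P0)) => [/(dissection_inner dD)|].
    by rewrite in0 inl0.
  rewrite segment_next => /eqP E.
  have := not_strictly_between_next (vtx P 0) (vtx P 1).
  rewrite -E /strictly_between !sorted_vtx_lt //; nlia.
have [i iP Ei] := vtxP inP.
have [|k [_ ki kout kin]] := @vtx_switch is_inner P 0 i (leq0n _) outer0.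
  by rewrite Ei.
have kP : (k.+1 < size P)%N by nlia.
have := eP _ (side_consec kP).
case: (vtx P k) (vtx P k.+1) kout kin => // a [//|b] _ _ [|//] Dab.
by exists a, b.
Qed.

Lemma bridge_shift (k : int) (i j : int) : D (inl i, inr j) ->
  D (inl (i + k * n%:Z), inr (j + k * m%:Z)).
Proof.
have fwd (l : nat) (a b : int) : D (inl a, inr b) <->
    D (inl (a + l%:Z * n%:Z), inr (b + l%:Z * m%:Z)).
  elim: l => [|l ->]; first by rewrite !mul0r !addr0.
  rewrite (dissection_deck dD) /= -!addrA -(addn1 l) PoszD !mulrDl !mul1r.
  by [].
case: k => l Dij; first by rewrite -fwd.
rewrite (fwd l.+1); suff [-> ->] : i + Negz l * n%:Z + l.+1%:Z * n%:Z = i /\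
  j + Negz l * m%:Z + l.+1%:Z * m%:Z = j by [].
by rewrite NegzE; split; ring.
Qed.

Hypotheses (n_gt0 : (0 < n)%N) (m_gt0 : (0 < m)%N).

Lemma bridge_right (N : int) : exists i j, [/\ N < i, N < j & D (inl i, inr j)].
Proof.
have [i [j Dij]] := bridge_exists.
pose k : int := `|N - i| + `|N - j| + 1.
exists (i + k * n%:Z), (j + k * m%:Z); split; last exact: bridge_shift.
- by rewrite /k; clear - n_gt0; nia.
- by rewrite /k; clear - m_gt0; nia.
Qed.

Lemma bridge_left (N : int) : exists i j, [/\ i < N, j < N & D (inl i, inr j)].
Proof.
have [i [j Dij]] := bridge_exists.
pose k : int := - (`|N - i| + `|N - j| + 1).
exists (i + k * n%:Z), (j + k * m%:Z); split; last exact: bridge_shift.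
- by rewrite /k; clear - n_gt0; nia.
- by rewrite /k; clear - m_gt0; nia.
Qed.

(** A sorted list is recovered from the boolean mask of its entries in [undup W]. *)
Lemma finite_sorted_sub (W : seq vertex) :
  finite_set [set P : seq vertex | sorted vlt P /\ {subset P <= W}].
Proof.
pose f (b : (size (undup W)).-tuple bool) := sort vle (mask b (undup W)).
apply: (@sub_finite_set _ _ (f @` setT)); last exact/finite_image/finite_finset.
move=> P [sP PW].
have sz : size [seq x \in P | x <- undup W] == size (undup W) by rewrite size_map.
exists (Tuple sz) => //=; rewrite /f /= -filter_mask.
apply: (@sorted_eq _ vle).
- by move=> y x z; exact: vle_trans.
- by move=> x y /andP[]; exact: vle_anti.
- apply: sort_sorted => x y; rewrite /vle -negb_and.
  by apply/negP => /andP[/vlt_trans h/h]; rewrite vltxx.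
- by apply: sub_sorted sP => x y; exact: vltW.
rewrite perm_sort; apply: uniq_perm.
- by rewrite filter_uniq ?undup_uniq.
- by apply: (sorted_uniq vlt_trans vltxx).
- move=> x; rewrite mem_filter mem_undup.
  by case: (boolP (x \in P)) => // /PW ->.
Qed.

(** Bridging arcs on either side of [v] confine its subgons to a finite window. Sums over infinite
    families would take the default value 0, so splitting corner sums relies on this. *)
Lemma finite_corners (v : vertex) :
  finite_set [set P | subgon D P /\ v \in P].
Proof.
pose N : int := match v with inl i | inr i => i end.
have [a [b [aN bN Df]]] := bridge_right N.
have [c [d [cN dN Dg]]] := bridge_left N.
pose W : seq (int + int) := [seq inl (c + k%:Z) | k <- iota 0 (`|a - c| + 1)] ++
  [seq inr (d + k%:Z) | k <- iota 0 (`|b - d| + 1)].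
apply: sub_finite_set (finite_sorted_sub W) => P /= [gP vP].
split; first by case: gP.
(* The vertices between the ends of a bridging arc are those to its right. *)
have vf : ~~ between (inl a) (inr b) v.
  by move: aN bN; rewrite /N /between /vle; clear; case: v => k /=; lia.
have vg : strictly_between (inl c) (inr d) v.
  by move: cN dN; rewrite /N /strictly_between; clear; case: v => k /=; lia.
move=> x xP; have xg := subgon_one_side Dg gP vP vg xP.
have xf : ~~ strictly_between (inl a) (inr b) x.
  by apply: contra vf => xf; exact: subgon_one_side Df gP xP xf vP.
rewrite mem_cat; apply/orP.
move: xg xf; rewrite /between /vle /strictly_between.
case: x {xP} => k /= h1 h2; [left|right].
- have -> : (inl k : vertex) = inl (c + `|k - c|%N%:Z) by congr inl; lia.
  by apply: (map_f (fun l : nat => inl (c + l%:Z) : (int + int)%type)); rewrite mem_iota; lia.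
- have -> : (inr k : vertex) = inr (d + `|k - d|%N%:Z) by congr inr; lia.
  by apply: (map_f (fun l : nat => inr (d + l%:Z) : (int + int)%type)); rewrite mem_iota; lia.
Qed.

(** * Corner sums behind an edge *)

Section Corners.
Context (R : realType).

(* The corners at v lying on the side of the edge (p, q) that faces the
   vertices between p and q. *)
Definition inner_corners (p q v : vertex) : set (seq vertex) :=
  [set P | [/\ subgon D P, v \in P & all (between p q) P]].

Definition csum (p q v : vertex) : R :=
  \sum_(P \in inner_corners p q v) lambda R (size P).

Lemma finite_inner_corners p q v : finite_set (inner_corners p q v).
Proof. by apply: sub_finite_set (finite_corners v) => P []. Qed.

Lemma fsbig_corner (Q : seq vertex) (A B : set (seq vertex)) : finite_set B ->
  ~ B Q -> A = [set Q] `|` B ->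
  \sum_(P \in A) lambda R (size P) =
  lambda R (size Q) + \sum_(P \in B) lambda R (size P).
Proof.
move=> fB BQ ->; rewrite fsbigU0 ?fsbig_set1 //.
by move=> P /= [-> ].
Qed.

Lemma subgon_not_between_next P p : subgon D P -> all (between p (vnext p)) P -> False.
Proof.
move=> [sz sP _ _] /allP h.
have /andP[h0 _] := h _ (mem_vtx (ltnW (ltnW sz))).
have /andP[_ h2] := h _ (mem_vtx sz).
have := not_strictly_between_next p (vtx P 1); rewrite /strictly_between.
rewrite (vle_lt_trans h0) ?sorted_vtx_lt ?(ltnW sz) //.
by rewrite (vlt_le_trans _ h2) // sorted_vtx_lt.
Qed.

Lemma csum_segment p v : csum p (vnext p) v = 0.
Proof.
rewrite /csum (_ : inner_corners _ _ _ = set0) ?fsbig_set0 //.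
by apply/seteqP; split => // P [gP _ /(subgon_not_between_next gP)].
Qed.

Lemma subgon_ends_between (Q : seq vertex) : subgon D Q ->
  all (between (vtx Q 0) (vtx Q (size Q).-1)) Q.
Proof.
move=> [sz sQ _ _]; apply/allP => x xQ; have [i iQ <-] := vtxP xQ.
by rewrite /between !sorted_vtx_le //; nlia.
Qed.

Lemma subgon_not_consec (Q : seq vertex) k : subgon D Q -> (k.+1 < size Q)%N ->
  ~~ all (between (vtx Q k) (vtx Q k.+1)) Q.
Proof.
move=> [sz sQ _ _] kQ; apply/negP => /allP h.
have [k2|k2] := ltnP k.+2 (size Q).
  by have /andP[_] := h _ (mem_vtx k2); rewrite /vle sorted_vtx_lt.
have Q0 : (0 < size Q)%N by nlia.
have /andP[+ _] := h _ (mem_vtx Q0).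
by rewrite /vle sorted_vtx_lt //; nlia.
Qed.

Lemma between_consec (Q : seq vertex) i k : sorted vlt Q -> (i < size Q)%N ->
  (k.+1 < size Q)%N -> between (vtx Q k) (vtx Q k.+1) (vtx Q i) ->
  i = k \/ i = k.+1.
Proof.
move=> sQ iQ kQ /andP[h1 h2].
have := sorted_vtx_leq sQ (ltnW kQ) h1; have := sorted_vtx_leq sQ iQ h2.
by clear; lia.
Qed.

Lemma between_sub p q p' q' (P : seq vertex) : vle p p' -> vle q' q ->
  all (between p' q') P -> all (between p q) P.
Proof.
move=> pp qq; apply: sub_all => x /andP[h1 h2].
by rewrite /between (vle_trans pp h1) (vle_trans h2 qq).
Qed.

(** By [subgon_nested], a corner here belongs to [Q] or lies behind the other side of [Q] at its
    first vertex. *)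
Lemma csum_first (Q : seq vertex) : subgon D Q ->
  csum (vtx Q 0) (vtx Q (size Q).-1) (vtx Q 0) =
  lambda R (size Q) + csum (vtx Q 0) (vtx Q 1) (vtx Q 0).
Proof.
move=> gQ; have [sz sQ _ _] := gQ.
have Q0 : (0 < size Q)%N by nlia.
have Q1 : (1 < size Q)%N by nlia.
apply: fsbig_corner; first exact: finite_inner_corners.
  by move=> [_ _]; apply/negP; exact: subgon_not_consec.
apply/seteqP; split => P.
- move=> [gP vP bP]; case: (subgon_nested gP gQ bP) => [|[k kQ bk]]; [by left|right].
  have /(between_consec sQ Q0 kQ) [E|//] := allP bk _ vP.
  by split=> //; rewrite -?E in bk.
- case=> [->|[gP vP bP]].
    by split; [|exact: mem_vtx|exact: subgon_ends_between].
  by split => //; apply: between_sub bP; [exact: vlexx|apply: sorted_vtx_le => //; nlia].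
Qed.

Lemma csum_last (Q : seq vertex) : subgon D Q ->
  csum (vtx Q 0) (vtx Q (size Q).-1) (vtx Q (size Q).-1) =
  lambda R (size Q) +
  csum (vtx Q (size Q).-2) (vtx Q (size Q).-1) (vtx Q (size Q).-1).
Proof.
move=> gQ; have [sz sQ _ _] := gQ.
have E1 : (size Q).-1 = (size Q).-2.+1 by nlia.
have Q1 : ((size Q).-1 < size Q)%N by nlia.
have Q2 : ((size Q).-2.+1 < size Q)%N by rewrite -E1.
apply: fsbig_corner; first exact: finite_inner_corners.
  by move=> [_ _]; apply/negP; rewrite E1; exact: subgon_not_consec.
apply/seteqP; split => P.
- move=> [gP vP bP]; case: (subgon_nested gP gQ bP) => [|[k kQ bk]]; [by left|right].
  have /(between_consec sQ Q1 kQ) [E|E] := allP bk _ vP.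
    by move: kQ; rewrite -E; clear -sz; lia.
  by split=> //; rewrite E.
- case=> [->|[gP vP bP]].
    by split; [|exact: mem_vtx|exact: subgon_ends_between].
  by split => //; apply: between_sub bP; [apply: sorted_vtx_le => //; nlia|exact: vlexx].
Qed.

(** The side joining the first and last vertex of [Q] confines all subgons at an interior vertex;
    each is [Q] or lies behind one of the two sides meeting there. *)
Lemma corner_sum_interior (Q : seq vertex) k : subgon D Q -> (k.+2 < size Q)%N ->
  corner_sum R D (vtx Q k.+1) = lambda R (size Q) +
    (csum (vtx Q k) (vtx Q k.+1) (vtx Q k.+1) +
     csum (vtx Q k.+1) (vtx Q k.+2) (vtx Q k.+1)).
Proof.
move=> gQ kQ2; have [sz sQ eQ _] := gQ; have kQ1 := ltnW kQ2; have kQ := ltnW kQ1.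
have Q0 : (0 < size Q)%N by nlia.
have Ql : ((size Q).-1 < size Q)%N by nlia.
rewrite /corner_sum; set A := inner_corners (vtx Q k) (vtx Q k.+1) (vtx Q k.+1).
set B := inner_corners (vtx Q k.+1) (vtx Q k.+2) (vtx Q k.+1).
have fA : finite_set A := finite_inner_corners _ _ _.
have fB : finite_set B := finite_inner_corners _ _ _.
rewrite (@fsbig_corner Q _ (A `|` B)).
- congr (_ + _); rewrite fsbigU0 // => P /= [[gP _ /allP bA] [_ _ /allP bB]].
  have [szP sP _ _] := gP; have P1 := ltnW szP; have P0 := ltnW P1.
  have /andP[_ h1] := bA _ (mem_vtx P1).
  have /andP[h0 _] := bB _ (mem_vtx P0).
  by have := vle_trans h1 h0; rewrite /vle sorted_vtx_lt.
- by rewrite finite_setU.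
- by case=> -[_ _]; apply/negP; exact: subgon_not_consec.
apply/seteqP; split => P /=; last first.
  by case=> [->|[[]|[]] //]; split => //; exact: mem_vtx.
move=> [gP vP].
have sk : strictly_between (vtx Q 0) (vtx Q (size Q).-1) (vtx Q k.+1).
  by rewrite /strictly_between !sorted_vtx_lt //; nlia.
have bP : all (between (vtx Q 0) (vtx Q (size Q).-1)) P.
  case: (eQ _ (side_ends Q0)) => [Dl|].
    by apply/allP => y; exact: (subgon_one_side Dl gP vP sk).
  rewrite segment_next => /eqP E; move: sk.
  by rewrite E (negbTE (not_strictly_between_next _ _)).
case: (subgon_nested gP gQ bP) => [|[l lQ bl]]; [by left|right].
have /(between_consec sQ kQ1 lQ) [E|[E]] := allP bl _ vP.
  by right; rewrite -E in bl.
by left; rewrite -E in bl.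
Qed.

(** * Developing maps and their compatibility along edges *)

(* Coordinates of a developing map: one vector per lifted marked point. *)
Definition solution (z : vertex -> R) : Prop :=
  forall v, z (vprev v) + z (vnext v) = corner_sum R D v * z v.

(* Says that q is the neighbour of p, and p that of q, obtained from the boundary
   neighbour by unfolding the subgons on the side between p and q. *)
Definition compat (z : vertex -> R) (p q : vertex) : Prop :=
  z q = z (vnext p) - csum p q p * z p /\
  z p = z (vprev q) - csum p q q * z q.

Lemma compat_segment z p : compat z p (vnext p).
Proof. by rewrite /compat !csum_segment !mul0r !subr0 vnextK. Qed.

(** Removing both [csum] terms from the corner sum at an interior vertex leaves the recurrence of a
    regular polygon, so [polygon_recurrence] gives the remaining side and the positivity. *)
Lemma compat_subgon z (Q : seq vertex) : solution z -> subgon D Q ->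
  (forall k, (k.+1 < size Q)%N -> compat z (vtx Q k) (vtx Q k.+1)) ->
  compat z (vtx Q 0) (vtx Q (size Q).-1) /\
  (0 < z (vtx Q 0) -> 0 < z (vtx Q (size Q).-1) ->
   forall x, x \in Q -> 0 < z x).
Proof.
move=> zs gQ gd; have [sz sQ eQ _] := gQ.
have [|k kQ|h1 h2 h3] := @polygon_recurrence R (size Q) (fun k => z (vtx Q k)) => //.
  have [_ ->] := gd _ (ltnW kQ); have [-> _] := gd _ kQ.
  have := zs (vtx Q k.+1); rewrite (corner_sum_interior gQ kQ) => E.
  rewrite addrACA E; ring.
split; last first.
  by move=> p0 pl x /vtxP[i iQ <-]; exact: h3.
have Q1 : (1 < size Q)%N by nlia.
split.
- rewrite csum_first // h1; have [-> _] := gd _ Q1; ring.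
- have E1 : (size Q).-1 = (size Q).-2.+1 by nlia.
  have Q2 : ((size Q).-2.+1 < size Q)%N by nlia.
  rewrite csum_last // h2; have [_] := gd _ Q2; rewrite -E1 => ->; ring.
Qed.

(** Both properties pass through the same induction on subgons. [W] serves to leave out the vertices
    beyond a fixed bridging arc, where positivity is not controlled. *)
Definition compat_pos (z : vertex -> R) (W : pred vertex) (p q : vertex) : Prop :=
  compat z p q /\
  (0 < z p -> 0 < z q -> forall x, W x -> between p q x -> 0 < z x).

Lemma compat_pos_segment z W p : compat_pos z W p (vnext p).
Proof.
split; first exact: compat_segment.
move=> zp zq x _ /andP[/vle_eqVlt[<- //|px] /vle_eqVlt[-> //|xq]].
by have := not_strictly_between_next p x; rewrite /strictly_between px xq.
Qed.

Lemma compat_pos_subgon z W (Q : seq vertex) : solution z -> subgon D Q ->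
  (forall k, (k.+1 < size Q)%N -> compat_pos z W (vtx Q k) (vtx Q k.+1)) ->
  compat_pos z W (vtx Q 0) (vtx Q (size Q).-1).
Proof.
move=> zs gQ gp; have [|gd pos] := compat_subgon zs gQ.
  by move=> k /gp[].
split=> // z0 zl x Wx /vtx_locate[->//|[k [kQ k1 k2]]].
have [_] := gp k kQ; apply => //; try by apply: pos => //; apply: mem_vtx => //; exact: ltnW.
by rewrite /between k1 vltW.
Qed.

Lemma subgon_between (p q : vertex) : D (p, q) ->
  exists Q, [/\ subgon D Q, vtx Q 0 = p & vtx Q (size Q).-1 = q].
Proof.
move=> /(dissection_between dD)[s gQ]; exists (p :: rcons s q); split => //.
by rewrite nth_last /= last_rcons.
Qed.

(** Makes the induction measures below decrease: with at least three vertices, a side joining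
    consecutive ones misses an end of [Q]. *)
Lemma consec_shrink (Q : seq vertex) k : subgon D Q -> (k.+1 < size Q)%N ->
  vlt (vtx Q 0) (vtx Q k) || vlt (vtx Q k.+1) (vtx Q (size Q).-1).
Proof.
move=> [sz sQ _ _]; case: k => [|k] kQ; apply/orP; [right|left].
  by apply: sorted_vtx_lt => //; nlia.
by apply: sorted_vtx_lt => //; nlia.
Qed.

Lemma subgon_vtx_between (Q : seq vertex) k : subgon D Q -> (k < size Q)%N ->
  between (vtx Q 0) (vtx Q (size Q).-1) (vtx Q k).
Proof. by move=> gQ kQ; apply: (allP (subgon_ends_between gQ)); exact: mem_vtx. Qed.

(** Only finitely many vertices lie between two outer points, so unfolding subgons ends at boundary
    segments. *)
Lemma compat_pos_outer z W (i j : int) : solution z -> edge D (inl i, inl j) ->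
  compat_pos z W (inl i) (inl j).
Proof.
move=> zs; have [N] : exists N : nat, (`|j - i| < N)%N by exists `|j - i|.+1.
elim: N i j => // N IHN i j ijN [Dij|]; last first.
  by rewrite segment_next => /eqP ->; exact: compat_pos_segment.
have [Q [gQ E0 El]] := subgon_between Dij; rewrite -E0 -El.
apply: compat_pos_subgon => // k kQ; have [_ _ eQ _] := gQ.
have := eQ _ (side_consec kQ).
have := consec_shrink gQ kQ.
have := subgon_vtx_between gQ kQ; have := subgon_vtx_between gQ (ltnW kQ).
rewrite E0 El; case: (vtx Q k) (vtx Q k.+1) => [c|c] [d|d]; rewrite /between /vle //=.
move=> h1 h2 h3 edg; have /= h4 := edge_lt edg; apply: IHN edg.
by clear - ijN h1 h2 h3 h4; lia.
Qed.

(** Infinitely many vertices lie to the right of a bridging arc, so the induction is on the distance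
    to the base arc [(inl a, inr b)]. In the subgon to the right of [(inl i, inr j)], sides with two
    outer ends fall to [compat_pos_outer], those with two inner ends are segments, and bridging ones
    are nearer to the base. *)
Lemma compat_pos_bridge z (a b i j : int) : solution z -> D (inl a, inr b) ->
  compat z (inl a) (inr b) -> i <= a -> j <= b -> D (inl i, inr j) ->
  compat_pos z (predC (strictly_between (inl a) (inr b))) (inl i) (inr j).
Proof.
move=> zs Dab gab.
have [N] : exists N : nat, (`|a - i| + `|b - j| < N)%N by exists (`|a - i| + `|b - j|).+1.
elim: N i j => // N IHN i j ijN ia jb Dij.
have [/andP[/eqP Ei /eqP Ej]|ne] := boolP ((i == a) && (j == b)).
  rewrite Ei Ej; split => // za zb x Wx /andP[/vle_eqVlt[<- //|ax] /vle_eqVlt[-> //|xb]].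
  by move: Wx; rewrite /= /strictly_between ax xb.
have [Q [gQ E0 El]] := subgon_between Dij; have [sz sQ eQ _] := gQ.
have Q0 : (0 < size Q)%N by nlia.
have Ql : ((size Q).-1 < size Q)%N by nlia.
(* Otherwise all of [Q] would lie weakly right of the base arc, so its end vertices would be those
   of the base arc, against [ne]. *)
have out (x : vertex) : x \in Q -> ~~ strictly_between (inl a) (inr b) x.
  move=> xQ; apply/negP => sx.
  have := subgon_one_side Dab gQ xQ sx (mem_vtx Q0).
  have := subgon_one_side Dab gQ xQ sx (mem_vtx Ql).
  rewrite E0 El /between /vle /=; clear - ia jb ne; lia.
rewrite -E0 -El; apply: compat_pos_subgon => // k kQ.
have := eQ _ (side_consec kQ).
have := consec_shrink gQ kQ.
have := subgon_vtx_between gQ kQ; have := subgon_vtx_between gQ (ltnW kQ).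
have := out _ (mem_vtx kQ); have := out _ (mem_vtx (ltnW kQ)).
rewrite E0 El; case: (vtx Q k) (vtx Q k.+1) => [c|c] [d|d] o1 o2 h1 h2 h3 edg.
- exact: compat_pos_outer.
- case: edg => // Dcd; move: o1 o2 h1 h2 h3.
  rewrite /strictly_between /between /vle /= => o1 o2 h1 h2 h3.
  by apply: IHN => //; clear - o1 o2 h1 h2 h3 ijN; lia.
- by have := edge_lt edg.
- case: edg => [/(dissection_inner dD)//|].
  by rewrite segment_next => /eqP ->; exact: compat_pos_segment.
Qed.

(** * Invariance under the deck transformation and its inverse *)

Section DeckInvariance.
Context (g : vertex -> vertex).
Hypotheses (g_lt : forall p q, vlt (g p) (g q) = vlt p q)
  (g_seg : forall p q, segment (g p, g q) = segment (p, q))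
  (g_D : forall p q, D (g p, g q) <-> D (p, q)).

Lemma vtx_map (P : seq vertex) k : (k < size P)%N -> vtx (map g P) k = g (vtx P k).
Proof. exact: nth_map. Qed.

Lemma edge_map p q : edge D (p, q) -> edge D (g p, g q).
Proof. by rewrite /edge g_seg => -[/g_D|]; [left|right]. Qed.

Lemma sides_map (P : seq vertex) p q :
  (p, q) \in sides P -> (g p, g q) \in sides (map g P).
Proof.
move=> pq; have P0 : (0 < size P)%N by case: P pq.
case: (sideP pq) => [[-> ->]|[k kP [-> ->]]].
  rewrite -!vtx_map //; last by rewrite prednK.
  by rewrite -(size_map g P); apply: side_ends; rewrite size_map.
rewrite -!vtx_map ?(ltnW kP) //.
by apply: side_consec; rewrite size_map.
Qed.

Lemma sides_mapP (P : seq vertex) e : e \in sides (map g P) ->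
  exists p q, (p, q) \in sides P /\ e = (g p, g q).
Proof.
move=> eP; have P0 : (0 < size P)%N by case: P eP.
have Pl : ((size P).-1 < size P)%N by rewrite prednK.
have := sideP eP; rewrite size_map => -[->|[k kP ->]].
  exists (vtx P 0), (vtx P (size P).-1); split; first exact: side_ends.
  by rewrite !vtx_map.
exists (vtx P k), (vtx P k.+1); split; first exact: side_consec.
by rewrite !vtx_map // ltnW.
Qed.

Lemma subgon_map (P : seq vertex) : subgon D P -> subgon D (map g P).
Proof.
move=> [sz sP eP dP]; split.
- by rewrite size_map.
- by rewrite sorted_map; apply: sub_sorted sP => p q /=; rewrite g_lt.
- by move=> e /sides_mapP[p [q [/eP pq ->]]]; exact: edge_map.
- move=> p q /vtxP[k + <-] /vtxP[l + <-]; rewrite !size_map => kP lP.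
  rewrite !vtx_map // => /g_D Dkl; apply: sides_map; apply: dP => //; exact: mem_vtx.
Qed.

Lemma mem_vtx_map (P : seq vertex) (v : vertex) : v \in P -> g v \in map g P.
Proof. exact: map_f. Qed.

Lemma all_between_map p q (P : seq vertex) :
  all (between p q) P -> all (between (g p) (g q)) (map g P).
Proof.
by rewrite all_map; apply: sub_all => x /=; rewrite /between /vle !g_lt.
Qed.

End DeckInvariance.

Definition undeck (p : vertex) : vertex :=
  match p with inl i => inl (i - n%:Z) | inr j => inr (j - m%:Z) end.

Lemma deckK : cancel (deck n m) undeck.
Proof. by case=> i /=; rewrite addrK. Qed.

Lemma undeckK : cancel undeck (deck n m).
Proof. by case=> i /=; rewrite subrK. Qed.

Lemma vlt_deck p q : vlt (deck n m p) (deck n m q) = vlt p q.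
Proof. by case: p q => [i|i] [j|j] //=; rewrite ltrD2r. Qed.

Lemma vlt_undeck p q : vlt (undeck p) (undeck q) = vlt p q.
Proof. by rewrite -vlt_deck !undeckK. Qed.

Lemma vnext_deck p : vnext (deck n m p) = deck n m (vnext p).
Proof. by case: p => i /=; rewrite addrAC. Qed.

Lemma vprev_deck p : vprev (deck n m p) = deck n m (vprev p).
Proof. by case: p => i /=; rewrite addrAC. Qed.

Lemma segment_deck p q : segment (deck n m p, deck n m q) = segment (p, q).
Proof. by rewrite !segment_next vnext_deck (can_eq deckK). Qed.

Lemma segment_undeck p q : segment (undeck p, undeck q) = segment (p, q).
Proof. by rewrite -segment_deck !undeckK. Qed.

Lemma D_deck p q : D (deck n m p, deck n m q) <-> D (p, q).
Proof. by rewrite -(dissection_deck dD). Qed.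

Lemma D_undeck p q : D (undeck p, undeck q) <-> D (p, q).
Proof. by rewrite -D_deck !undeckK. Qed.

Lemma fsbig_deck (A B : set (seq vertex)) :
  (forall P, A P -> B (map (deck n m) P)) ->
  (forall P, B P -> A (map undeck P)) ->
  \sum_(P \in B) lambda R (size P) = \sum_(P \in A) lambda R (size P).
Proof.
move=> AB BA; rewrite (@reindex_fsbig _ _ _ _ _ (map (deck n m)) A B).
  by under eq_fsbigr do rewrite size_map.
split => [P /AB //|P Q _ _ /(inj_map (can_inj deckK))//|P BP].
by exists (map undeck P); [exact: BA|exact: mapK undeckK _].
Qed.

Lemma corner_sum_deck v : corner_sum R D (deck n m v) = corner_sum R D v.
Proof.
apply: fsbig_deck => P [gP vP].
- split; first exact: (subgon_map vlt_deck segment_deck D_deck).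
  exact: mem_vtx_map.
- split; first exact: (subgon_map vlt_undeck segment_undeck D_undeck).
  by rewrite -(deckK v); exact: mem_vtx_map.
Qed.

Lemma csum_deck p q v : csum (deck n m p) (deck n m q) (deck n m v) = csum p q v.
Proof.
apply: fsbig_deck => P [gP vP bP].
- split; first exact: (subgon_map vlt_deck segment_deck D_deck).
    exact: mem_vtx_map.
  exact: all_between_map vlt_deck _ _ _ bP.
- split; first exact: (subgon_map vlt_undeck segment_undeck D_undeck).
    by rewrite -(deckK v); exact: mem_vtx_map.
  by rewrite -(deckK p) -(deckK q); exact: all_between_map vlt_undeck _ _ _ bP.
Qed.

(** * The plane of compatible solutions and its monodromy *)

Lemma solution_outer z : solution z ->
  recurrence (fun i => corner_sum R D (inl i)) (fun i => z (inl i)).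
Proof. by move=> zs i; exact: (zs (inl i)). Qed.

Lemma solution_inner z : solution z ->
  recurrence (fun i => corner_sum R D (inr i)) (fun i => z (inr i)).
Proof. by move=> zs i; rewrite addrC; exact: (zs (inr i)). Qed.

Lemma solution_exists (a b : int) (s t : R) : exists z,
  [/\ solution z, compat z (inl a) (inr b), z (inl a) = s & z (inl (a + 1)) = t].
Proof.
set c := csum (inl a) (inr b) (inl a); set c' := csum (inl a) (inr b) (inr b).
have [u [ru ua ua1]] := recurrence_exists (fun i => corner_sum R D (inl i)) a s t.
(* The inner starting values at [b] and [b + 1] are solved from the two equations of [compat];
   [b + 1] is the predecessor of [b] in the boundary order. *)
have [w [rw wb wb1]] := recurrence_exists (fun i => corner_sum R D (inr i)) b
  (t - c * s) (s + c' * (t - c * s)).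
exists (fun v => match v with inl i => u i | inr j => w j end); split => //.
- by move=> [i|j] /=; [exact: ru|rewrite addrC; exact: rw].
- by rewrite /compat /= -/c -/c' wb wb1 ua ua1 addrK.
Qed.

Lemma solution_lin (x y : R) z1 z2 : solution z1 -> solution z2 ->
  solution (fun v => x * z1 v + y * z2 v).
Proof. by move=> s1 s2 v; rewrite addrACA -!mulrDr s1 s2; ring. Qed.

Lemma compat_lin (x y : R) z1 z2 p q : compat z1 p q -> compat z2 p q ->
  compat (fun v => x * z1 v + y * z2 v) p q.
Proof.
move=> [h1 h2] [h3 h4]; split.
- by rewrite h1 h3; ring.
- by rewrite {1}h2 {1}h4; ring.
Qed.

Lemma solution_deck z : solution z -> solution (z \o deck n m).
Proof.
by move=> zs v; rewrite /= -vnext_deck -vprev_deck zs corner_sum_deck.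
Qed.

Lemma compat_deck z p q : compat z (deck n m p) (deck n m q) ->
  compat (z \o deck n m) p q.
Proof. by rewrite /compat /= vnext_deck vprev_deck !csum_deck. Qed.

(** Compatibility carries two consecutive zeros on the outer boundary to two on the inner one, so
    both recurrences vanish identically. *)
Lemma solution_eq0 z (i j : int) : solution z -> compat z (inl i) (inr j) ->
  z (inl i) = 0 -> z (inl (i + 1)) = 0 -> forall v, z v = 0.
Proof.
move=> zs [/= h1 h2] zi zi1.
have zj : z (inr j) = 0 by rewrite h1 zi zi1 mulr0 subr0.
have zj1 : z (inr (j + 1)) = 0 by move: h2; rewrite zi zj mulr0 subr0.
case=> k; first exact: (recurrence_eq0 (solution_outer zs) zi zi1).
exact: (recurrence_eq0 (solution_inner zs) zj zj1).
Qed.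

(** Along the edge, the vector at [q] differs from that at [vnext p] by a multiple of the vector at
    [p], which leaves the determinant unchanged; likewise at the other end. *)
Lemma compat_wronskian z1 z2 p q : compat z1 p q -> compat z2 p q ->
  wronskian z1 z2 p q = wronskian z1 z2 p (vnext p) /\
  wronskian z1 z2 p q = wronskian z1 z2 (vprev q) q.
Proof.
move=> [h1 h2] [h3 h4]; split.
- by rewrite /wronskian h1 h3; ring.
- by rewrite /wronskian h2 h4; ring.
Qed.

(** The deck translate of [z] is a solution compatible along the same bridging arc, hence a
    combination of [z1] and [z2]. That one pair [x], [y] serves both boundaries is what links the
    two friezes. *)
Lemma monodromy z1 z2 z (i j : int) : solution z1 -> solution z2 -> solution z ->
  compat z1 (inl i) (inr j) -> compat z2 (inl i) (inr j) ->
  compat z (deck n m (inl i)) (deck n m (inr j)) ->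
  wronskian z1 z2 (inl i) (inl (i + 1)) = 1 ->
  exists x y, forall v, z (deck n m v) = x * z1 v + y * z2 v.
Proof.
move=> s1 s2 s g1 g2 g w1.
set p : vertex := inl i; set p1 : vertex := inl (i + 1).
set c := z (deck n m p); set d := z (deck n m p1).
(* Cramer's rule, with determinant 1 by [w1]. *)
exists (c * z2 p1 - d * z2 p), (d * z1 p - c * z1 p1) => v.
set x := c * z2 p1 - _; set y := d * z1 p - _.
pose h v := 1 * (z \o deck n m) v + (-1) * (x * z1 v + y * z2 v).
suff : h v = 0 by rewrite /h /= => h0; apply/eqP; rewrite -subr_eq0 -h0; apply/eqP; ring.
apply: (@solution_eq0 h i j).
- by apply: solution_lin; [exact: solution_deck|exact: solution_lin].
- by apply: compat_lin; [exact: compat_deck|exact: compat_lin].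
- rewrite /h /= -/p -/c -[c in LHS]mulr1 -w1 -/p -/p1 /wronskian /x /y; ring.
- rewrite /h /= -/p1 -/d -[d in LHS]mulr1 -w1 -/p -/p1 /wronskian /x /y; ring.
Qed.

(** * Growth coefficients as traces *)

(** An instance of det(p, T q) + det(T p, q) = tr(T) det(p, q), with p and q the vectors at 0 and
    1. *)
Lemma growth1_trace (N : nat) (M : int -> int -> R) (u v : int -> R)
    (x1 y1 x2 y2 : R) : (0 < N)%N ->
  (forall i j, 0 <= i -> i <= j -> j <= N%:Z + 1 -> M i j = wronskian u v i j) ->
  wronskian u v 0 1 = 1 ->
  (forall i, u (i + N%:Z) = x1 * u i + y1 * v i) ->
  (forall i, v (i + N%:Z) = x2 * u i + y2 * v i) ->
  growth1 N M = x1 + y2.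
Proof.
move=> N0 ME w1 uN vN; rewrite /growth1 !ME //; try lia.
have := uN 0; have := vN 0; rewrite !add0r => v0 u0.
have := uN 1; have := vN 1; rewrite ![1 + _]addrC => v1 u1.
by rewrite /wronskian u0 u1 v0 v1 -[RHS]mulr1 -w1 /wronskian; ring.
Qed.

Lemma growth1_in_out (Mout Min : int -> int -> R) :
  is_out_frieze D Mout -> is_in_frieze D Min ->
  growth1 m Min = growth1 n Mout.
Proof.
move=> [Fout Qout] [Fin Qin].
(* All entries entering the growth coefficients lie between these two arcs, and the deck translate
   of the left arc is still left of the right one. *)
have [i [j [i0 j0 De]]] := bridge_left 0.
have [a [b [aN bN Df]]] := bridge_right (n%:Z + m%:Z + 2).
have [z1 [s1 f1 z1a z1a1]] := solution_exists a b 1 0.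
have [z2 [s2 f2 z2a z2a1]] := solution_exists a b 0 1.
have Dde : D (deck n m (inl i), deck n m (inr j)) by rewrite D_deck.
have compat_e z : solution z -> compat z (inl a) (inr b) -> compat z (inl i) (inr j).
  move=> zs gf; have [||//] := compat_pos_bridge zs Df gf _ _ De.
    by clear - i0 aN; lia.
  by clear - j0 bN; lia.
have compat_de z : solution z -> compat z (inl a) (inr b) ->
    compat z (deck n m (inl i)) (deck n m (inr j)).
  move=> zs gf; have [||//] := compat_pos_bridge zs Df gf _ _ Dde.
    by clear - i0 aN; lia.
  by clear - j0 bN; lia.
have wout k : wronskian z1 z2 (inl k) (inl (k + 1)) = 1.
  have := wronskian_const a (solution_outer s1) (solution_outer s2) k.
  by rewrite /wronskian z1a z2a z1a1 z2a1 mulr1 mulr0 subr0.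
(* [z1] and [z2] are swapped because inner indices decrease along [vlt]; the value 1 is carried
   across the right bridging arc. *)
have win k : wronskian z2 z1 (inr k) (inr (k + 1)) = 1.
  have := wronskian_const b (solution_inner s2) (solution_inner s1) k.
  rewrite /wronskian => ->; have [h1 h2] := compat_wronskian f1 f2.
  transitivity (wronskian z1 z2 (vprev (inr b)) (inr b)).
    by rewrite /wronskian /=; ring.
  by rewrite -h2 h1; exact: wout.
have wij : wronskian z1 z2 (inl i) (inr j) = 1.
  by have [-> _] := compat_wronskian (compat_e _ s1 f1) (compat_e _ s2 f2); exact: wout.
(* The combination equal to [wronskian z1 z2 (inl i) (inr j)], which is 1, at both ends of the left
   arc; positivity spreads from there over the window. *)
pose f v := (z2 (inr j) - z2 (inl i)) * z1 v + (z1 (inl i) - z1 (inr j)) * z2 v.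
have sf : solution f by exact: solution_lin.
have ff : compat f (inl a) (inr b) by exact: compat_lin.
have f_pos v : between (inl i) (inr j) v ->
    ~~ strictly_between (inl a) (inr b) v -> 0 < f v.
  have [||_] := compat_pos_bridge sf Df ff _ _ De.
  - by clear - i0 aN; lia.
  - by clear - j0 bN; lia.
  move=> H bv nv; apply: H => //.
  - by rewrite (_ : f _ = 1) // -wij /f /wronskian; ring.
  - by rewrite (_ : f _ = 1) // -wij /f /wronskian; ring.
have Mout_w := frieze_wronskian (lo := 0) (hi := n%:Z + 1) Fout Qout
  (solution_outer s1) (solution_outer s2) (solution_outer sf) wout.
have Min_w := frieze_wronskian (lo := 0) (hi := m%:Z + 1) Fin Qin
  (solution_inner s2) (solution_inner s1) (solution_inner sf) win.
have [x1 [y1 E1]] := monodromy s1 s2 s1 (compat_e _ s1 f1) (compat_e _ s2 f2)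
  (compat_de _ s1 f1) (wout i).
have [x2 [y2 E2]] := monodromy s1 s2 s2 (compat_e _ s1 f1) (compat_e _ s2 f2)
  (compat_de _ s2 f2) (wout i).
rewrite (@growth1_trace n Mout (fun i => z1 (inl i)) (fun i => z2 (inl i)) x1 y1 x2 y2) //.
(* Swapping the basis exchanges the diagonal entries of the monodromy matrix and keeps its trace. *)
- rewrite (@growth1_trace m Min (fun i => z2 (inr i)) (fun i => z1 (inr i)) y2 x2 y1 x1) //.
  + by rewrite addrC.
  + apply: Min_w => k k0 km; apply: f_pos; rewrite /between /strictly_between /vle /=.
      by clear - j0 k0; lia.
    by clear - bN km; lia.
  + exact: win.
  + by move=> k; rewrite [RHS]addrC; exact: (E2 (inr k)).
  + by move=> k; rewrite [RHS]addrC; exact: (E1 (inr k)).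
- apply: Mout_w => k k0 km; apply: f_pos; rewrite /between /strictly_between /vle /=.
    by clear - i0 k0; lia.
  by clear - aN km; lia.
- exact: wout.
- by move=> k; exact: (E1 (inl k)).
- by move=> k; exact: (E2 (inl k)).
Qed.

End Corners.
End Subgons.
End Dissection.

Theorem theorem7p14 (R : realType) (n m : nat) (D : set (vertex * vertex))
    (Mout Min : int -> int -> R) :
  0 < n -> 0 < m ->
  dissection n m D ->
  is_out_frieze D Mout ->
  is_in_frieze D Min ->
  growth1 m Min = growth1 n Mout.
Proof. by move=> n_gt0 m_gt0 dD; exact: (growth1_in_out dD). Qed.
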